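(* A pure simplicial complex $\Delta$ is strongly shellable if and only if its codimension one graph $\Gamma(\Delta)$ is harmonious with respect to $\Delta$ and $\Gamma(\Delta)$ has a distance-preserving order.
   Context: A simplicial complex $\Delta$ is a finite family of subsets of a vertex set closed under taking subsets; $\mathcal{F}(\Delta)$ is its set of facets, $\dim(A)=|A|-1$; $\Delta$ is pure if all facets have the same dimension. A linear order $F_1,\dots,F_t$ of $\mathcal{F}(\Delta)$ is a strong shelling order if for every $1\le i<j\le t$ there exists $k$ with $1\le k<j$ such that $|F_j\setminus F_k|=1$, $F_j\setminus F_k\subseteq F_j\setminus F_i$, and $F_k\setminus F_j\subseteq F_i$; $\Delta$ is strongly shellable if such an order exists. For facets $F,G$, $\operatorname{dis}_\Delta(F,G):=\min(\dim F,\dim G)-\dim(F\cap G)$ $(=\min(|F\setminus G|,|G\setminus F|))$. The codimension one graph $\Gamma(\Delta)$ is the simple graph with vertex set $\mathcal{F}(\Delta)$ in which $F,G$ are adjacent iff $\operatorname{dis}_\Delta(F,G)=1$. $\Gamma(\Delta)$ is harmonious with respect to $\Delta$ if $\operatorname{dis}_\Delta(F,G)=\operatorname{dis}_{\Gamma(\Delta)}(F,G)$ for all facets $F,G$, where $\operatorname{dis}_{\Gamma(\Delta)}$ is the graph distance (possibly $+\infty$). For a finite simple graph $G$, an ordering $v_1,\dots,v_t$ of its vertices is a distance-preserving order if, writing $G_0=G$ and $G_k$ for the induced subgraph on $\{v_{k+1},\dots,v_t\}$, for each $1\le i<t-1$ one has $\operatorname{dis}_{G_i}(u,v)=\operatorname{dis}_{G_{i-1}}(u,v)$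 for all vertices $u,v$ of $G_i$. *)

(* Defs.v *)
From mathcomp Require Import all_boot all_order all_algebra.

Set Implicit Arguments.
Unset Strict Implicit.
Unset Printing Implicit Defensive.

Import Order.TTheory GRing.Theory Num.Theory.

Section SimplicialComplex.
Variable V : finType.
Implicit Types (D : {set {set V}}) (A B F G : {set V}) (s : seq {set V}).

(* The void complex (no face at all) and points of V lying in no face are
   both allowed. *)
Definition simplicial_complex D : Prop :=
  forall A B, A \in D -> B \subset A -> B \in D.

Definition facets D : {set {set V}} := [set F | maxset (fun A => A \in D) F].

(* An integer, since dim set0 = -1. *)
Definition dim A : int := (#|A|%:Z - 1)%R.

Definition pure D : Prop :=
  forall F G, F \in facets D -> G \in facets D -> dim F = dim G.

(* Positions are 0-based: F_1, ..., F_t is nth set0 s 0, ..., nth set0 s t.-1. *)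
Definition strong_shelling_order D s : Prop :=
  [/\ uniq s, s =i facets D &
    forall i j, i < j < size s ->
      exists2 k, k < j &
        [/\ #|nth set0 s j :\: nth set0 s k| = 1,
            nth set0 s j :\: nth set0 s k \subset nth set0 s j :\: nth set0 s i
          & nth set0 s k :\: nth set0 s j \subset nth set0 s i]].

Definition strongly_shellable D : Prop := exists s, strong_shelling_order D s.

Definition dis F G : int := (Num.min (dim F) (dim G) - dim (F :&: G))%R.

Lemma dis_sym F G : dis F G = dis G F.
Proof. by rewrite /dis minC setIC. Qed.

Lemma disxx F : dis F F = 0%R.
Proof. by rewrite /dis minxx setIid subrr. Qed.

End SimplicialComplex.

(* Finite simple graphs whose vertices are drawn from an ambient finite type,
   so that a graph and its induced subgraphs share the type of vertices. *)
Record sgraph (T : finType) := SGraph {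
  vertices : {set T};
  adj : rel T;
  adj_vertices : forall x y, adj x y -> (x \in vertices) && (y \in vertices);
  adj_sym : symmetric adj;
  adj_irr : irreflexive adj }.

Section Graph.
Variable T : finType.
Implicit Types (G : sgraph T) (x y : T) (S : {set T}) (s : seq T).

Definition induced_adj G S : rel T :=
  [rel x y | [&& x \in S, y \in S & adj G x y]].

Fact induced_vertices G S x y : induced_adj G S x y ->
  (x \in vertices G :&: S) && (y \in vertices G :&: S).
Proof.
by case/and3P=> xS yS /adj_vertices/andP[xG yG]; rewrite !inE xG yG xS yS.
Qed.

Fact induced_sym G S : symmetric (induced_adj G S).
Proof. by move=> x y; rewrite /induced_adj /= adj_sym andbCA. Qed.

Fact induced_irr G S : irreflexive (induced_adj G S).
Proof. by move=> x; rewrite /induced_adj /= adj_irr !andbF. Qed.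

Definition induced G S : sgraph T :=
  SGraph (@induced_vertices G S) (@induced_sym G S) (@induced_irr G S).

Definition has_path G x y (n : nat) : bool :=
  [exists p : n.-tuple T,
    [&& path (adj G) x p, uniq (x :: p) & last x p == y]].

Fact connect_has_path G x y : connect (adj G) x y -> exists n, has_path G x y n.
Proof.
case/connectP=> p /shortenP[q Gq uq _] ->; exists (size q).
by apply/existsP; exists (in_tuple q); rewrite Gq uq eqxx.
Qed.

(* Length of a shortest path; None stands for +oo.  Only meaningful when x and
   y are vertices of G. *)
Definition gdist G x y : option nat :=
  match @idP (connect (adj G) x y) with
  | ReflectT Gxy => Some (ex_minn (connect_has_path Gxy))
  | ReflectF _ => None
  end.

(* drop k s lists v_{k+1}, ..., v_t; as s lists all vertices, G_ 0 has the same
   vertices and edges as G. *)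
Definition distance_preserving_order G s : Prop :=
  [/\ uniq s, s =i vertices G &
    let G_ k := induced G [set x in drop k s] in
    forall i, 0 < i < (size s).-1 ->
      forall u v, u \in vertices (G_ i) -> v \in vertices (G_ i) ->
        gdist (G_ i) u v = gdist (G_ i.-1) u v].

Definition has_distance_preserving_order G : Prop :=
  exists s, distance_preserving_order G s.

End Graph.

Section CodimensionOneGraph.
Variables (V : finType) (D : {set {set V}}).

Definition codim1_adj : rel {set V} :=
  [rel F G | [&& F \in facets D, G \in facets D & dis F G == 1%R]].

Fact codim1_vertices F G :
  codim1_adj F G -> (F \in facets D) && (G \in facets D).
Proof. by case/and3P=> -> ->. Qed.

Fact codim1_sym : symmetric codim1_adj.
Proof. by move=> F G; rewrite /codim1_adj /= dis_sym andbCA. Qed.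

Fact codim1_irr : irreflexive codim1_adj.
Proof. by move=> F; rewrite /codim1_adj /= disxx !andbF. Qed.

Definition codim1_graph : sgraph {set V} :=
  SGraph codim1_vertices codim1_sym codim1_irr.

Definition harmonious : Prop :=
  forall F G, F \in facets D -> G \in facets D ->
    omap Posz (gdist codim1_graph F G) = Some (dis F G).

End CodimensionOneGraph.

(* Main.v *)
(** For facets of a pure complex [dis F G] equals [#|F :\: G|], a metric, so a
path between facets [F] and [G] in any subgraph of the codimension one graph has
length at least [dis F G].  The facet [F_k] in the strong shelling condition is
exactly a neighbour of [F_j] that is closer to [F_i] by one.  Hence an order of
the facets is a strong shelling order iff every initial segment, of at least two
facets, induces a subgraph whose graph distance is [dis]; reversing the order
turns this into harmony together with preservation of distances. *)
Require Import Defs.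
From mathcomp Require Import all_boot all_order all_algebra.
From mathcomp Require Import zify.

Set Implicit Arguments.
Unset Strict Implicit.
Unset Printing Implicit Defensive.

Import Order.TTheory.

Section CardSetD.
Variable V : finType.
Implicit Types F G H : {set V}.

Lemma card_setD_sym F G : #|F| = #|G| -> #|F :\: G| = #|G :\: F|.
Proof.
by move=> eqFG; rewrite !cardsD (setIC G) eqFG.
Qed.

Lemma card_setD_triangle F G H : #|F :\: H| <= #|F :\: G| + #|G :\: H|.
Proof.
apply: leq_trans (leq_card_setU _ _); apply: subset_leq_card.
apply/subsetP=> x; rewrite !inE.
by case: (x \in F); case: (x \in G); case: (x \in H).
Qed.

(** Both sides equal [#|F| - #|F :&: G :&: H|], as seen by splitting each of [F] and [G] along [H],
    and its trace on [H] along the other set. *)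
Lemma card_setD_exchange F G H : #|F| = #|G| ->
  #|F :\: H| + #|(F :\: G) :&: H| = #|G :\: H| + #|(G :\: F) :&: H|.
Proof.
move=> eqFG.
have splitH A B : #|A :&: H| = #|A :&: B :&: H| + #|(A :\: B) :&: H|.
  by rewrite -(cardsID B (A :&: H)) setIAC setIDAC.
have FH := cardsID H F; have GH := cardsID H G.
have := splitH F G; have := splitH G F; rewrite (setIC G F).
lia.
Qed.

(** Both [F :\: G] and [G :\: F] are singletons, so in the exchange identity their traces on [H]
    count 0 or 1. A strict decrease means exactly that the first trace is empty and the second is
    full. *)
Lemma exchange_closer F G H : #|F| = #|G| -> #|F :\: G| = 1 ->
  (F :\: G \subset F :\: H) && (G :\: F \subset H) = (#|G :\: H| < #|F :\: H|).
Proof.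
move=> eqFG FG1; have GF1 : #|G :\: F| = 1 by rewrite -card_setD_sym.
have exch := card_setD_exchange H eqFG.
have -> : (F :\: G \subset F :\: H) = (#|(F :\: G) :&: H| == 0).
  by rewrite subsetD subsetDl cards_eq0 setI_eq0.
have -> : (G :\: F \subset H) = (#|(G :\: F) :&: H| == 1).
  apply/setIidPl/eqP=> [-> // | GFH].
  by apply/eqP; rewrite eqEcard subsetIl GF1 GFH.
have := subset_leq_card (subsetIl (F :\: G) H).
have := subset_leq_card (subsetIl (G :\: F) H).
rewrite FG1 GF1; lia.
Qed.

Lemma dis_card_setD F G : #|F| = #|G| -> dis F G = #|F :\: G|%:Z%R.
Proof.
move=> eqFG; have := cardsID G F; rewrite /dis /Defs.dim eqFG minxx; lia.
Qed.

End CardSetD.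

Section GraphDistance.
Variable T : finType.
Implicit Types (G : sgraph T) (x y : T).

(** [gdist] minimises over paths without repeated vertices; shortening a walk lets all walks
    compete, which is easier to use. *)
Lemma gdistP G x y n :
  gdist G x y = Some n <->
  (exists p, [/\ path (adj G) x p, last x p = y & size p = n]) /\
  (forall p, path (adj G) x p -> last x p = y -> n <= size p).
Proof.
have short p : path (adj G) x p -> last x p = y ->
    exists2 m, m <= size p & has_path G x y m.
  move=> Gp <-; case/shortenP: Gp => q Gq uq /(uniq_leq_size) qp.
  exists (size q); first by apply: qp; case/andP: uq.
  by apply/existsP; exists (in_tuple q); rewrite Gq uq eqxx.
rewrite /gdist; case: {-}_ / idP => [Gxy | nGxy]; last first.
  split=> // -[[p [Gp pl _]] _]; case: nGxy.
  by apply/connectP; exists p.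
case: ex_minnP => m /existsP[q /and3P[Gq _ /eqP ql]] minm.
split=> [[<-] | [[p [Gp pl <-]] minp]].
  split=> [|p Gp pl]; first by exists q; rewrite size_tuple.
  by have [k kp /minm] := short p Gp pl; move/leq_trans; apply.
congr Some; apply/eqP; rewrite eqn_leq.
have := minp _ Gq ql; rewrite size_tuple => ->; rewrite andbT.
by have [k kp /minm] := short p Gp pl; move/leq_trans; apply.
Qed.

Lemma eq_gdist G G' x y : adj G =2 adj G' -> gdist G x y = gdist G' x y.
Proof.
move=> eqG.
have imp n H H' : adj H =2 adj H' ->
    gdist H x y = Some n -> gdist H' x y = Some n.
  move=> eqH /gdistP[[p [Hp pl sp]] minp]; apply/gdistP; split.
    by exists p; rewrite -(eq_path eqH).
  by move=> q Hq; apply: minp; rewrite (eq_path eqH).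
case E: (gdist G x y) => [n|]; first by rewrite (imp n _ _ eqG E).
case E': (gdist G' x y) => [n|] //.
by rewrite (imp n _ _ (fun u v => esym (eqG u v)) E') in E.
Qed.

End GraphDistance.

Section PureComplex.
Variables (V : finType) (D : {set {set V}}).
Hypothesis pureD : pure D.
Implicit Types (F G : {set V}) (S : {set {set V}}) (s : seq {set V}).

Lemma pure_card F G : F \in facets D -> G \in facets D -> #|F| = #|G|.
Proof. by move=> FD GD; have := pureD FD GD; rewrite /Defs.dim; lia. Qed.

Lemma dis_facets F G :
  F \in facets D -> G \in facets D -> dis F G = #|F :\: G|%:Z%R.
Proof. by move=> FD GD; apply/dis_card_setD/pure_card. Qed.

Lemma codim1_adjE F G :
  codim1_adj D F G =
  [&& F \in facets D, G \in facets D & #|F :\: G| == 1].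
Proof.
rewrite /codim1_adj /=; case: (boolP (F \in _)) => //= FD.
by case: (boolP (G \in _)) => //= GD; rewrite dis_facets.
Qed.

Lemma codim1_path_size F p :
  path (codim1_adj D) F p -> #|F :\: last F p| <= size p.
Proof.
elim: p F => [|G p IHp] F /=; first by rewrite setDv cards0.
rewrite codim1_adjE => /andP[/and3P[_ _ /eqP FG1] /IHp].
by have := card_setD_triangle F G (last G p); rewrite FG1; lia.
Qed.

(** Minimality is free: every walk in a subgraph obeys the bound of [codim1_path_size]. Only a walk
    of the right length has to be found. *)
Lemma gdist_codim1 (H : sgraph {set V}) F G :
  subrel (adj H) (codim1_adj D) ->
  gdist H F G = Some #|F :\: G| <->
  exists p, [/\ path (adj H) F p, last F p = G & size p = #|F :\: G|].
Proof.
move=> subH; split=> [/gdistP[] // | Hp]; apply/gdistP; split=> // p Gp <-.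
exact/codim1_path_size/(sub_path subH).
Qed.

(** Distances are compared with a quantity independent of [S], so that different induced subgraphs
    can be compared through it. *)
Definition isometric S : Prop :=
  forall F G, F \in S -> G \in S ->
    gdist (induced (codim1_graph D) S) F G = Some #|F :\: G|.

Lemma induced_codim1 S :
  subrel (adj (induced (codim1_graph D) S)) (codim1_adj D).
Proof. by move=> F G /and3P[]. Qed.

Lemma isometric_facetsP : isometric (facets D) <-> harmonious D.
Proof.
have eqg F G : gdist (induced (codim1_graph D) (facets D)) F G
                 = gdist (codim1_graph D) F G.
  apply: eq_gdist => A B; rewrite /= /induced_adj /= /codim1_adj /=.
  by case: (A \in facets D); case: (B \in facets D).
split=> iso F G FD GD.
  by rewrite -eqg iso // dis_facets.
have := iso F G FD GD; rewrite dis_facets // eqg.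
by case: gdist => //= n [->].
Qed.

(** Of two distinct facets, the one later in [s] can be replaced by an earlier neighbour one step
    closer to the other. The replacement stays in the initial segment, so iterating builds a path of
    the required length. *)
Lemma shelling_isometric s m :
  strong_shelling_order D s -> isometric [set F in take m s].
Proof.
case=> us sD shell F G; set S := [set _ in _] => FS GS.
apply/gdist_codim1; first exact: induced_codim1.
have SD A : A \in S -> A \in facets D by rewrite inE => /mem_take; rewrite sD.
have closer A B : A \in S -> B \in S -> index B s < index A s ->
    exists C, [/\ C \in S, adj (induced (codim1_graph D) S) A C
                & #|A :\: B| = #|C :\: B|.+1].
  move=> AS BS ltBA; have [AD BD] := (SD _ AS, SD _ BS).
  have [As Bs] : A \in s /\ B \in s by rewrite !sD.
  have ijs : index B s < index A s < size s by rewrite ltBA index_mem.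
  have [k kA] := shell _ _ ijs; rewrite !nth_index //.
  set C := nth _ _ _; case=> AC1 AC CA.
  have ks : k < size s by apply: ltn_trans kA _; rewrite index_mem.
  have CS : C \in S.
    rewrite inE in_take /C ?mem_nth // index_uniq //.
    by move: AS; rewrite inE in_take //; apply: ltn_trans.
  exists C; split=> //.
    by apply/and3P; split; rewrite //= codim1_adjE AD SD // AC1.
  (* The exchange makes the distance to [B] drop, and the triangle inequality limits the drop to
     one. *)
  have := exchange_closer B (pure_card AD (SD _ CS)) AC1.
  rewrite AC CA; have := card_setD_triangle A C B; rewrite AC1; lia.
have [n] := ubnP #|F :\: G|; elim: n F G FS GS => // n IHn F G FS GS ltFGn.
have cardS A B : A \in S -> B \in S -> #|A :\: B| = #|B :\: A|.
  by move=> AS BS; apply/card_setD_sym/pure_card; apply: SD.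
have [ltGF | ltFG | eqi] := ltngtP (index G s) (index F s).
- have [C [CS FC FGC]] := closer _ _ FS GS ltGF.
  have [|p [Cp pl sp]] := IHn C G CS GS; first by lia.
  by exists (C :: p); split; [apply/andP | | rewrite /= sp FGC].
(* Here the endpoint [G] is the later facet, so the path is extended at its end. *)
- have [C [CS GC GFC]] := closer _ _ GS FS ltFG.
  have [|p [Fp pl sp]] := IHn F C FS CS.
    by rewrite cardS // -ltnS -GFC cardS.
  exists (rcons p G); split; rewrite ?last_rcons ?size_rcons //.
    by rewrite rcons_path Fp pl adj_sym.
  by rewrite sp (cardS F C) // (cardS F G).
- have -> : F = G.
    by rewrite -(@nth_index _ set0 F s) -?eqi ?nth_index ?sD ?SD.
  by exists [::]; rewrite setDv cards0.
Qed.

(** For [i < j], the required facet is the second vertex of a shortest path from the [j]-th to the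
    [i]-th facet inside the segment ending at the [j]-th. *)
Lemma isometric_shelling s : uniq s -> s =i facets D ->
  (forall m, 1 < m <= size s -> isometric [set F in take m s]) ->
  strong_shelling_order D s.
Proof.
move=> us sD iso; split=> // i j /andP[ltij ltjs].
have ltis := ltn_trans ltij ltjs.
set F := nth _ s j; set H := nth _ s i.
have [Fs Hs] : F \in s /\ H \in s by rewrite !mem_nth.
set S := [set A in take j.+1 s].
have isoS : isometric S by apply: iso; rewrite ltjs andbT; lia.
have FS : F \in S by rewrite inE in_take // index_uniq.
have HS : H \in S by rewrite inE in_take // index_uniq // ltnS ltnW.
have /gdist_codim1[|[|G p] [Fp pl sp]] := isoS _ _ FS HS.
- exact: induced_codim1.
- move/eqP: pl; rewrite /= nth_uniq // => /eqP eqij.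
  by rewrite eqij ltnn in ltij.
case/andP: Fp => /and3P[_ GS FG] Gp.
move: FG; rewrite /= codim1_adjE => /and3P[FD GD /eqP FG1].
(* [G] lies in the segment and differs from its last facet [F], since [F :\: G] is nonempty. *)
have ltGj : index G s < j.
  have Gs : G \in s by rewrite sD.
  move: GS; rewrite inE in_take // ltnS leq_eqVlt => /predU1P[eqGj | //].
  by move: FG1; rewrite /F -eqGj nth_index // setDv cards0.
exists (index G s) => //; rewrite nth_index ?sD //.
(* The rest of the path joins [G] to [H] with one edge less. *)
have : #|G :\: H| < #|F :\: H|.
  rewrite -sp -pl /= ltnS; apply: codim1_path_size.
  exact: sub_path (@induced_codim1 S) _ _ Gp.
by rewrite -(exchange_closer H (pure_card FD GD) FG1) => /andP[].
Qed.

End PureComplex.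

Lemma set_drop_rev (T : finType) (s : seq T) k :
  [set x in drop k (rev s)] = [set x in take (size s - k) s].
Proof. by apply/setP=> x; rewrite !inE drop_rev mem_rev. Qed.

Theorem theorem4p7 (V : finType) (D : {set {set V}}) :
  simplicial_complex D -> pure D ->
  (strongly_shellable D <->
     harmonious D /\ has_distance_preserving_order (codim1_graph D)).
Proof.
move=> _ pureD; split=> [[s shell] | [harm [s [us sD dpo]]]].
  have [us sD _] := shell; split.
    apply/(isometric_facetsP pureD).
    suff <- : [set F in take (size s) s] = facets D.
      exact: shelling_isometric.
    by apply/setP=> F; rewrite inE take_size sD.
  exists (rev s); split=> [|F|G_ i _ F G]; rewrite ?rev_uniq ?mem_rev ?sD //.
  rewrite !inE /G_ => /andP[_ Fi] /andP[_ Gi].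
  have drop_pred A : A \in drop i (rev s) -> A \in drop i.-1 (rev s).
    by case: i {Fi Gi} => // i; rewrite -addn1 addnC -drop_drop => /mem_drop.
  (* The tails of [rev s] are initial segments of [s], so both distances equal [#|F :\: G|]. *)
  have iso j := shelling_isometric pureD (m := size s - j) shell.
  by rewrite !set_drop_rev !iso // -set_drop_rev inE // drop_pred.
(* Harmony is the case [k = 0], and each deletion preserves distances. The bound keeps at least two
   facets, the range that [dpo] covers. *)
have iso k : k < (size s).-1 -> isometric D [set F in drop k s].
  elim: k => [_ | k IHk ltks F G Fk Gk].
    suff -> : [set F in drop 0 s] = facets D by apply/isometric_facetsP.
    by apply/setP=> F; rewrite inE drop0 sD.
  have dropS A : A \in [set F in drop k.+1 s] ->
      (A \in [set F in drop k s]) && (A \in facets D).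
    rewrite inE => Ak; rewrite -[A \in facets D]sD (mem_drop Ak) andbT inE.
    by move: Ak; rewrite -add1n -drop_drop => /mem_drop.
  have /andP[Fk' FD] := dropS F Fk; have /andP[Gk' GD] := dropS G Gk.
  rewrite (dpo k.+1) //=; first by apply: IHk; rewrite // ltnW.
    by rewrite inE FD.
  by rewrite inE GD.
exists (rev s); apply: isometric_shelling => // [|F|m];
  rewrite ?rev_uniq ?mem_rev ?sD //.
rewrite size_rev => /andP[m1 ms].
have -> : [set F in take m (rev s)] = [set F in drop (size s - m) s].
  by apply/setP=> F; rewrite !inE take_rev mem_rev.
(* [1 < m] is what puts [size s - m] below [(size s).-1]. *)
apply: iso; move: m1 ms; case: (size s) => [|n]; lia.
Qed.
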